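(* Fix an integer $k \geq 1$ and $\epsilon \in (0, \frac{4}{k+1})$. Let $\mathcal{P}$ be any hereditary hypergraph property. Suppose there exists a non-decreasing function $f$ such that every $(k+1)$-uniform hypergraph $H \in \mathcal{P}$ with $n$ vertices and average degree at most $t$ satisfies \[ \alpha(H) \geq \frac{n}{t^{1/k}}f(t). \] Then there exists $n_0 = n_0(\epsilon)$ such that every $(k+1)$-uniform hypergraph $H \in \mathcal{P}$ with $n \geq n_0$ vertices and average degree at most $t < n^k$ satisfies \[ i(H) \geq e^{\alpha' \frac{n}{t^{1/k}}\ln t}, \] where \[ \alpha' = \begin{cases} (1-n^{-\epsilon/21})\frac{1}{k+1}f\!\left(t^{\frac{1}{k+1}}\right), & \text{if $H$ is linear},\\[4pt] (1-n^{-\epsilon/21})\frac{1-\epsilon}{k(2k+1)}f\!\left(t^{\frac{2k+\epsilon}{2k+1}}\right), & \text{otherwise}. \end{cases} \]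
   Context: A hereditary hypergraph property $\mathcal{P}$ is a set of hypergraphs closed under vertex deletion (i.e., under taking induced subhypergraphs). A hypergraph is $(k+1)$-uniform if every edge has exactly $k+1$ vertices; it is linear if any two distinct edges share at most one vertex. The degree of a vertex is the number of edges containing it; the average degree of a $(k+1)$-uniform hypergraph $H$ is $(k+1)|E(H)|/|V(H)|$. An independent set is a set of vertices containing no edge; $\alpha(H)$ is the maximum size of an independent set and $i(H)$ is the number of independent sets of $H$. All logarithms are natural logarithms.
   Formalization: The function f is additionally assumed nonnegative on the positive reals (a negative constant f with t = 1/2 and an edgeless hypergraph refutes the statement otherwise), and t is taken to be positive so that t^{1/k} in the denominator and ln t make sense. *)

(* Defs.v *)
From HB Require Import structures.
From mathcomp Require Import all_boot all_order all_algebra.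
From mathcomp Require Import all_classical all_reals all_analysis.

Set Implicit Arguments.
Unset Strict Implicit.
Unset Printing Implicit Defensive.

Import Order.TTheory GRing.Theory Num.Theory.

Local Open Scope ring_scope.

Record hypergraph := Hypergraph {
  vertices : finType;
  edges : {set {set vertices}}
}.

Definition order_hg (H : hypergraph) : nat := #|vertices H|.

Definition uniform_hg (r : nat) (H : hypergraph) : bool :=
  [forall e in edges H, #|e| == r].

Definition linear_hg (H : hypergraph) : bool :=
  [forall e1 in edges H, forall e2 in edges H,
    (e1 != e2) ==> (#|e1 :&: e2| <= 1)%N].

(* The edges of the induced subhypergraph are the edges of H contained in S,
   transported to the subtype of the elements of S. *)
Definition induced_hg (H : hypergraph) (S : {set vertices H}) : hypergraph :=
  @Hypergraph {x : vertices H | x \in S}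
    [set e : {set {x : vertices H | x \in S}} | (val @: e) \in edges H].

(* Closure under isomorphism is not required: only closure under passing to
   an induced subhypergraph is. *)
Definition hereditary_hg (P : hypergraph -> Prop) : Prop :=
  forall (H : hypergraph) (S : {set vertices H}), P H -> P (induced_hg S).

Definition indep_hg (H : hypergraph) (S : {set vertices H}) : bool :=
  [forall e in edges H, ~~ (e \subset S)].

Definition alpha_hg (H : hypergraph) : nat :=
  \max_(S : {set vertices H} | indep_hg S) #|S|.

Definition num_indep_hg (H : hypergraph) : nat :=
  #|[set S : {set vertices H} | indep_hg S]|.

(* Meaningful for r-uniform H; equal to 0 when H has no vertex. *)
Definition avg_degree_hg (R : realType) (r : nat) (H : hypergraph) : R :=
  r%:R * #|edges H|%:R / (order_hg H)%:R.

Definition alpha'_hg (R : realType) (k : nat) (eps : R) (f : R -> R)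
    (H : hypergraph) (t : R) : R :=
  let n : R := (order_hg H)%:R in
  if linear_hg H then
    (1 - n `^ (- (eps / 21))) * (1 / (k%:R + 1)) * f (t `^ (1 / (k%:R + 1)))
  else
    (1 - n `^ (- (eps / 21))) * ((1 - eps) / (k%:R * (2 * k%:R + 1)))
      * f (t `^ ((2 * k%:R + eps) / (2 * k%:R + 1))).

(* Main.v *)
Require Import Defs.
From HB Require Import structures.
From mathcomp Require Import all_boot all_order all_algebra.
From mathcomp Require Import all_classical all_reals all_analysis.
From mathcomp Require Import fintype finset zify ring lra.

Set Implicit Arguments.
Unset Strict Implicit.
Unset Printing Implicit Defensive.

Import Order.TTheory GRing.Theory Num.Theory.

Local Open Scope ring_scope.

(* Sample a uniform subset W of m = (1 - o(1)) n t^(-c) vertices, where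
   c = 1/(k+1) or c = (1 - eps)/(k(2k+1)).  The mean of the average degree of
   H[W] is below s = t^(1 - kc), so by heredity a positive fraction phi of the
   samples contains an independent set of size a >= m f(s) / s^(1/k).  An
   independent set of size a lies in at most a fraction (m/n)^a of the samples,
   hence i(H) >= phi (n/m)^a.  Markov's inequality gives phi >= n^(-eps/21)/4,
   which suffices when n / t^(1/k) is at least n^(eps/20), since then either the
   target exponent is large or deletion alone gives enough independent sets.
   For larger t, Chebyshev's inequality gives phi >= 1 - n^(-eps/21)/4. *)

(** Nothing bounds [f] from below by a power of n, so the target exponent X = [exponent_hg] may be
    small; this is the obstacle. With d = n^(-eps/21)/4, a fraction phi = d of good samples costs ln
    (1/d), while the statement tolerates only a relative loss of order d in X; so d X must dominate
    ln n. It does once X exceeds n^(eps/20)/8, because 1/20 > 1/21. A smaller X is beaten by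
    deletion, whose exponent n / (8 t^(1/k)) does not involve [f], as long as n / t^(1/k) >=
    n^(eps/20). Beyond that range t is nearly n^k, sampled degrees are still a positive power of n,
    and concentration brings phi so close to 1 that X >= 1 is enough. Samples have exactly m
    elements, so every probability is a quotient of binomial coefficients and the argument is finite
    counting. *)

(** * Containment probabilities as binomial quotients *)

Lemma mul_bin_sub n m j : (j < m)%N -> (m <= n)%N ->
  ((n - j) * 'C(n - j.+1, m - j.+1) = (m - j) * 'C(n - j, m - j))%N.
Proof.
move=> jm mn; have := mul_bin_diag (n - j) (m - j.+1).
by rewrite -subnS subnSK.
Qed.

(** 'C(n - j, m - j) / 'C(n, m) is the product of the factors (m - i) / (n - i) for i < j, each at
    most m / n. *)
Lemma leq_expn_bin n m j : (j <= m)%N -> (m <= n)%N ->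
  (n ^ j * 'C(n - j, m - j) <= m ^ j * 'C(n, m))%N.
Proof.
elim: j => [|j IH] jm mn; first by rewrite !expn0 !mul1n !subn0.
have /= E := mul_bin_sub jm mn.
have nj : (0 < n - j)%N by lia.
have step : (n * 'C(n - j.+1, m - j.+1) <= m * 'C(n - j, m - j))%N.
  rewrite -(leq_pmul2l nj) mulnCA E !mulnA leq_mul2r; apply/orP; right; nia.
rewrite !expnS -mulnA mulnCA (leq_trans (leq_mul (leqnn (n ^ j)) step)) //.
by rewrite mulnCA -mulnA leq_mul2l IH ?orbT // ltnW.
Qed.

(** Negative correlation in numerical form. Raising i by one multiplies the left side by (m - i - j)
    / (n - i - j) and the right side by the larger (m - i) / (n - i). *)
Lemma bin_sub_submul n m i j : (i + j <= m)%N -> (m <= n)%N ->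
  ('C(n - (i + j), m - (i + j)) * 'C(n, m)
   <= 'C(n - i, m - i) * 'C(n - j, m - j))%N.
Proof.
elim: i => [|i IH] ijm mn; first by rewrite !subn0 mulnC.
have ijm' : (i + j < m)%N by lia.
have E1 := mul_bin_sub ijm' mn.
have im : (i < m)%N by lia.
have E2 := mul_bin_sub im mn.
have := IH (ltnW ijm') mn; rewrite addSn.
move: E1 E2.
set a := 'C(n - (i + j).+1, _); set a' := 'C(n - (i + j), _).
set b := 'C(n - i.+1, _); set b' := 'C(n - i, _).
set x := 'C(n, m); set y := 'C(n - j, _) => E1 E2 le1.
have p1 : (0 < n - (i + j))%N by lia.
have p2 : (0 < n - i)%N by lia.
rewrite -(leq_pmul2l p1) -(leq_pmul2l p2) [X in (_ * X <= _)%N]mulnA E1.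
have -> : ((n - i) * ((n - (i + j)) * (b * y)) =
   (n - (i + j)) * (((n - i) * b) * y))%N by ring.
rewrite E2.
have -> : ((n - i) * ((m - (i + j)) * a' * x) =
  ((n - i) * (m - (i + j))) * (a' * x))%N by ring.
have -> : ((n - (i + j)) * ((m - i) * b' * y) =
  ((n - (i + j)) * (m - i)) * (b' * y))%N by ring.
by apply: leq_mul => //; nia.
Qed.

(** * Counting the samples that contain a given set *)

Definition draws (V : finType) (m : nat) : {set {set V}} :=
  [set W : {set V} | #|W| == m].

Definition draws_above (V : finType) (m : nat) (A : {set V}) : {set {set V}} :=
  [set W in draws V m | A \subset W].

Lemma card_draws_above (V : finType) (m : nat) (A : {set V}) : (#|A| <= m)%N ->
  #|draws_above m A| = 'C(#|V| - #|A|, m - #|A|).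
Proof.
move=> Am; have <- : #|~: A| = (#|V| - #|A|)%N by rewrite [#|~: A|]cardsCs setCK.
rewrite -(cards_draws (~: A) (m - #|A|)%N).
rewrite -(card_in_imset (f := fun S : {set V} => A :|: S)); last first.
  move=> S T; rewrite !inE => /andP[SA _] /andP[TA _] E.
  have aux (U : {set V}) : U \subset ~: A -> (A :|: U) :\: A = U.
    move=> UA; rewrite setDUl setDv set0U; apply/setDidPl.
    by rewrite disjoints_subset.
  by rewrite -(aux S SA) E aux.
apply: eq_card => W; rewrite !inE; apply/andP/imsetP.
- case=> /eqP Wm AW; exists (W :\: A); last by rewrite setUC setDE setUIl
    [~: A :|: A]setUC setUCr setIT; apply/esym/setUidPl.
  by rewrite inE subDset setUCr subsetT cardsD (setIidPr AW) Wm eqxx.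
- case=> S; rewrite inE => /andP[SA /eqP Sm] ->; split; last exact: subsetUl.
  rewrite cardsU Sm; have -> : A :&: S = set0.
    by apply/eqP; rewrite setI_eq0 disjoint_sym disjoints_subset.
  by rewrite cards0 subn0 subnKC.
Qed.

(** Kept apart from [card_draws_above]: beyond size m, truncated subtraction would make the binomial
    coefficient equal to 1. *)
Lemma draws_above_eq0 (V : finType) (m : nat) (A : {set V}) : (m < #|A|)%N ->
  #|draws_above m A| = 0%N.
Proof.
move=> mA; apply: eq_card0 => W; rewrite !inE.
apply/andP => -[/eqP Wm AW].
by have := subset_leq_card AW; rewrite Wm leqNgt mA.
Qed.

Lemma card_draws_aboveI_le (V : finType) (m : nat) (A B : {set V}) :
  [disjoint A & B] -> (m <= #|V|)%N ->
  (#|draws_above m (A :|: B)| * #|draws V m|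
   <= #|draws_above m A| * #|draws_above m B|)%N.
Proof.
move=> dAB mV.
have cU : #|A :|: B| = (#|A| + #|B|)%N.
  by move: dAB; rewrite -setI_eq0 cardsU => /eqP ->; rewrite cards0 subn0.
have [/draws_above_eq0 -> //|Um] := ltnP m #|A :|: B|.
rewrite !card_draws_above //; try lia.
by rewrite /draws card_draws cU bin_sub_submul // -cU.
Qed.

Lemma card_draws_above_le (V : finType) (m : nat) (A : {set V}) :
  (m <= #|V|)%N ->
  (#|V| ^ #|A| * #|draws_above m A| <= m ^ #|A| * #|draws V m|)%N.
Proof.
move=> mV; have [/draws_above_eq0 ->|Am] := ltnP m #|A|; first by rewrite muln0.
by rewrite card_draws_above // /draws card_draws leq_expn_bin.
Qed.

(** * Moments of the number of sampled edges *)

Definition edges_in (V : finType) (E : {set {set V}}) (W : {set V}) :=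
  [set e in E | e \subset W].

Lemma sum_edges_in (V : finType) (E : {set {set V}}) (m : nat) :
  (\sum_(W in draws V m) #|edges_in E W| = \sum_(e in E) #|draws_above m e|)%N.
Proof.
under eq_bigr do rewrite -sum1_card.
under [RHS]eq_bigr do rewrite -sum1_card.
rewrite (exchange_big_dep (mem E)) /=; last by move=> W e _; rewrite inE => /andP[].
apply: eq_bigr => e eE; apply: eq_bigl => W; by rewrite !inE eE.
Qed.

Lemma sum_edges_in_le (V : finType) (E : {set {set V}}) (r m : nat) :
  (m <= #|V|)%N -> {in E, forall e : {set V}, #|e| = r} ->
  (#|V| ^ r * (\sum_(W in draws V m) #|edges_in E W|)
   <= #|E| * (m ^ r * #|draws V m|))%N.
Proof.
move=> mV Er; rewrite sum_edges_in big_distrr /= -sum_nat_const.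
by apply: leq_sum => e eE; rewrite -(Er e eE) card_draws_above_le.
Qed.

Lemma card_meeting_le (V : finType) (F : {set {set V}}) (D : nat) (e : {set V}) :
  (forall v, #|[set e' in F | v \in e']| <= D)%N ->
  (#|[set e' in F | ~~ [disjoint e & e']]| <= #|e| * D)%N.
Proof.
move=> hD; rewrite -sum_nat_const.
apply: (@leq_trans (\sum_(v in e) #|[set e' in F | v \in e']|)%N); last first.
  by apply: leq_sum => v _; exact: hD.
apply: (@leq_trans #|\bigcup_(v in e) [set e' in F | v \in e']|); last first.
  elim/big_rec2: _ => [|v A n _ IH]; first by rewrite cards0.
  by rewrite (leq_trans (leq_card_setU _ _)) // leq_add2l.
apply: subset_leq_card; apply/subsetP => e'; rewrite inE => /andP[e'F].
rewrite -setI_eq0 => /set0Pn[v]; rewrite inE => /andP[ve ve'].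
by apply/bigcupP; exists v => //; rewrite inE e'F.
Qed.

(* Pairs of disjoint edges are negatively correlated under sampling without
   replacement, so only meeting pairs contribute to the variance. *)
Lemma sum_sqr_edges_in_le (V : finType) (E : {set {set V}}) (r m D : nat) :
  (m <= #|V|)%N -> {in E, forall e : {set V}, #|e| = r} ->
  {in draws V m, forall W v, #|[set e in edges_in E W | v \in e]| <= D}%N ->
  (#|draws V m| * \sum_(W in draws V m) #|edges_in E W| ^ 2
   <= (\sum_(W in draws V m) #|edges_in E W|) ^ 2
      + #|draws V m| * (r * D * \sum_(W in draws V m) #|edges_in E W|))%N.
Proof.
move=> mV Er hD; set N := #|draws V m|.
(* Ordered pairs of sampled edges are split by disjointness; a given edge meets at most r * D
   sampled edges, itself included. *)
have split_sq W : W \in draws V m -> (#|edges_in E W| ^ 2 <=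
    \sum_(e in edges_in E W) \sum_(e' in edges_in E W | [disjoint e & e']) 1
    + r * D * #|edges_in E W|)%N.
  move=> Wm; rewrite -mulnn -[X in (X * _ <= _)%N]sum1_card.
  rewrite -[X in (_ <= _ + _ * X)%N]sum1_card !big_distrl big_distrr /=.
  rewrite -big_split /=; apply: leq_sum => e eW; rewrite mul1n muln1.
  rewrite -sum1_card (bigID (fun e' : {set V} => [disjoint e & e'])) /= leq_add2l.
  have -> : r = #|e| by rewrite Er //; move: eW; rewrite inE => /andP[].
  apply: leq_trans (card_meeting_le e (hD W Wm)); rewrite -sum1_card.
  by apply: eq_leq; apply: eq_bigl => e'; rewrite !inE.
apply: leq_trans; first by apply: leq_mul (leqnn N) (leq_sum _ split_sq).
rewrite big_split /= mulnDr -big_distrr /= leq_add2r.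
have -> : (\sum_(W in draws V m) \sum_(e in edges_in E W)
    \sum_(e' in edges_in E W | [disjoint e & e']) 1 =
  \sum_(e in E) \sum_(e' in E | [disjoint e & e']) #|draws_above m (e :|: e')|)%N.
  rewrite (exchange_big_dep (mem E)) /=; last by move=> W e _; rewrite inE => /andP[].
  apply: eq_bigr => e eE; under [RHS]eq_bigr do rewrite -sum1_card.
  rewrite (exchange_big_dep (fun e' : {set V} => (e' \in E) && [disjoint e & e'])) /=; last first.
    by move=> W e' _ /andP[]; rewrite inE => /andP[-> _].
  apply: eq_bigr => e' /andP[e'E dee']; apply: eq_bigl => W.
  by rewrite !inE eE e'E dee' subUset andbT /= andbA.
rewrite sum_edges_in -mulnn big_distrlr /= big_distrr /=.
apply: leq_sum => e eE; rewrite big_distrr /=.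
rewrite [X in (_ <= X)%N](bigID (fun e' : {set V} => [disjoint e & e'])) /=.
apply: leq_trans (leq_addr _ _); apply: leq_sum => e' /andP[e'E dee'].
by rewrite mulnC card_draws_aboveI_le.
Qed.

(** An edge through v is determined by its other k vertices, a k-subset of W. *)
Lemma card_edges_at_le (V : finType) (E : {set {set V}}) (k m : nat) (W : {set V}) v :
  {in E, forall e : {set V}, #|e| = k.+1} -> #|W| = m ->
  (#|[set e in edges_in E W | v \in e]| <= m ^ k)%N.
Proof.
move=> Er Wm.
rewrite -(card_in_imset (f := fun e : {set V} => e :\ v)); last first.
  move=> e e'; rewrite !inE => /andP[_ ve] /andP[_ ve'] E1.
  by rewrite -(setD1K ve) E1 setD1K.
apply: (@leq_trans 'C(#|W|, k)); last first.
  rewrite Wm; case: (posnP m) => [->|m0].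
    by case: k {Er} => [|k]; rewrite ?bin0 // bin0n.
  apply: (@leq_trans ('C(m, k) * k`!)%N); first by rewrite leq_pmulr ?fact_gt0.
  rewrite bin_ffact; elim: k {Er} => [|k IH]; first by rewrite ffactn0.
  by rewrite ffactnSr expnSr leq_mul // leq_subr.
rewrite -cards_draws subset_leq_card //; apply/subsetP => e.
case/imsetP => e'; rewrite !inE => /andP[/andP[e'E e'W] ve'] ->.
rewrite (subset_trans (subD1set _ _) e'W) /=.
by have := Er _ e'E; rewrite (cardsD1 v) ve' add1n => -[->].
Qed.

(** Linearity makes the edges through v disjoint outside v, so choosing in each a vertex other than
    v (there is one, as k > 0) is injective into W. *)
Lemma card_edges_at_linear_le (V : finType) (E : {set {set V}}) (k m : nat)
    (W : {set V}) v :
  (0 < k)%N -> {in E, forall e : {set V}, #|e| = k.+1} ->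
  {in E &, forall e1 e2 : {set V}, e1 != e2 -> #|e1 :&: e2| <= 1}%N -> #|W| = m ->
  (#|[set e in edges_in E W | v \in e]| <= m)%N.
Proof.
move=> k0 Er lin <-.
set F := [set e in _ | _].
have FP e : e \in F -> [/\ e \in E, e \subset W & v \in e].
  by rewrite !inE => /andP[/andP[]].
have trivF : {in F &, forall e1 e2 x, x \in e1 :\ v -> x \in e2 :\ v -> e1 = e2}.
  move=> e1 e2 /FP[E1 _ v1] /FP[E2 _ v2] x; rewrite !inE.
  move=> /andP[xv x1] /andP[_ x2]; apply/eqP; apply: contraTT (isT) => ne.
  have := lin _ _ E1 E2 ne; rewrite leqNgt => /negP; case.
  rewrite (cardsD1 v) inE v1 v2 add1n ltnS card_gt0.
  by apply/set0Pn; exists x; rewrite !inE xv x1.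
pose g (e : {set V}) := odflt v [pick x in e :\ v].
have gP e : e \in F -> g e \in e :\ v.
  move=> eF; rewrite /g; case: pickP => //= e0.
  have [eE _ ve] := FP _ eF; have := Er _ eE; rewrite (cardsD1 v) ve.
  by rewrite (eq_card0 e0) add1n => -[] kE; rewrite -kE in k0.
rewrite -(card_in_imset (f := g)); last first.
  by move=> e1 e2 F1 F2 E12; apply: (trivF e1 e2 F1 F2 (g e1)); rewrite ?gP // E12 gP.
apply: subset_leq_card; apply/subsetP => x /imsetP[e eF ->].
have [_ /subsetP eW _] := FP _ eF; apply: eW.
by have := gP _ eF; rewrite inE => /andP[].
Qed.

(* Each independent set of size a lies in at most a fraction (m/|V|)^a of the
   m-subsets, while every W in G contains one. *)
Lemma card_draws_le_indep (V : finType) (I G : {set {set V}}) (a m : nat) :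
  (m <= #|V|)%N -> G \subset draws V m ->
  {in G, forall W : {set V}, exists2 S, S \in I & (S \subset W) && (#|S| == a)} ->
  (#|V| ^ a * #|G| <= #|I| * (m ^ a * #|draws V m|))%N.
Proof.
move=> mV Gm hG.
have le1 : (#|G| <= \sum_(S in I | #|S| == a) #|draws_above m S|)%N.
  apply: (@leq_trans #|\bigcup_(S in I | #|S| == a) draws_above m S|); last first.
    elim/big_rec2: _ => [|v A n _ IH]; first by rewrite cards0.
    by rewrite (leq_trans (leq_card_setU _ _)) // leq_add2l.
  apply: subset_leq_card; apply/subsetP => W WG.
  have [S SI /andP[SW Sa]] := hG _ WG.
  apply/bigcupP; exists S; first by rewrite SI Sa.
  by rewrite inE SW andbT; exact: (subsetP Gm).
apply: (leq_trans (leq_mul (leqnn _) le1)); rewrite big_distrr /= -sum_nat_const.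
rewrite big_mkcondr; apply: leq_sum => S _; case: ifP => // /eqP <-.
exact: card_draws_above_le.
Qed.

(** * Induced subhypergraphs and independent sets *)

Lemma uniform_hgP (r : nat) (H : hypergraph) :
  uniform_hg r H -> {in edges H, forall e : {set vertices H}, #|e| = r}.
Proof. by move=> /forallP u e eE; have /implyP/(_ eE)/eqP := u e. Qed.

Lemma order_induced_hg (H : hypergraph) (S : {set vertices H}) :
  order_hg (induced_hg S) = #|S|.
Proof. by rewrite /order_hg /= card_sig; apply: eq_card => x; rewrite !inE. Qed.

Lemma uniform_induced_hg (r : nat) (H : hypergraph) (S : {set vertices H}) :
  uniform_hg r H -> uniform_hg r (induced_hg S).
Proof.
move=> /uniform_hgP u; apply/forallP => e; apply/implyP; rewrite inE => /u <-.
by rewrite card_imset //; exact: val_inj.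
Qed.

Lemma card_edges_induced_hg (H : hypergraph) (S : {set vertices H}) :
  #|edges (induced_hg S)| = #|edges_in (edges H) S|.
Proof.
rewrite -(card_imset (f := fun e : {set {x | x \in S}} => val @: e)); last first.
  by apply: imset_inj; exact: val_inj.
apply: eq_card => e; rewrite inE; apply/imsetP/andP.
- case=> e'; rewrite inE => eE ->; split=> //.
  by apply/subsetP => x /imsetP[[y yS] _ ->].
- case=> eE /subsetP eS.
  have Ee : e = val @: [set x : {x | x \in S} | val x \in e].
    apply/setP => x; apply/idP/imsetP => [xe|[y]]; last by rewrite inE => ? ->.
    by exists (exist _ x (eS x xe)); rewrite ?inE.
  by exists [set x : {x | x \in S} | val x \in e]; rewrite ?inE -?Ee.
Qed.

Lemma indep_hgS (H : hypergraph) (S T : {set vertices H}) :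
  S \subset T -> indep_hg T -> indep_hg S.
Proof.
move=> ST /forallP iT; apply/forallP => e; apply/implyP => eE.
by apply: contra (implyP (iT e) eE) => /subset_trans; exact.
Qed.

Lemma small_indep_hg (k : nat) (H : hypergraph) (S : {set vertices H}) :
  uniform_hg k.+1 H -> (#|S| <= k)%N -> indep_hg S.
Proof.
move=> /uniform_hgP u Sk; apply/forallP => e; apply/implyP => eE.
by apply/negP => /subset_leq_card; rewrite u // leqNgt ltnS Sk.
Qed.

(** A maximum independent set of the sample stays independent in H: an edge of H inside it lies in
    W, hence is already an edge of the induced subhypergraph. *)
Lemma alpha_induced_hgP (k : nat) (H : hypergraph) (W : {set vertices H}) :
  uniform_hg k.+1 H ->
  exists S : {set vertices H},
    [/\ indep_hg S, S \subset W & #|S| = alpha_hg (induced_hg W)].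
Proof.
move=> uH; have u := uniform_induced_hg W uH.
have [|S iS maxS] := @eq_bigmax_cond _ (@indep_hg (induced_hg W)) (fun S => #|S|).
  apply/card_gt0P; exists set0; apply: (small_indep_hg u).
  by rewrite cards0.
exists (val @: S); split; last first.
  by rewrite card_imset; [exact: esym maxS|exact: val_inj].
- by apply/subsetP => x /imsetP[[y yW] _ ->].
- apply/forallP => e; apply/implyP => eE; apply/negP => eS.
  pose e' := [set x : {x | x \in W} | val x \in e].
  have Ee : val @: e' = e.
    apply/setP => x; apply/imsetP/idP => [[y]|xe]; first by rewrite inE => ? ->.
    have /imsetP[y yS Ex] := subsetP eS x xe.
    by exists y; rewrite // inE -Ex.
  have /forallP/(_ e')/implyP := iS.
  rewrite inE Ee eE => /(_ isT)/negP; apply; apply/subsetP => x; rewrite inE.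
  by move=> /(subsetP eS)/imsetP[y yS /val_inj ->].
Qed.

(** Remove from W one vertex of each edge contained in W. *)
Lemma indep_deletion (k : nat) (H : hypergraph) (W : {set vertices H}) :
  uniform_hg k.+1 H ->
  exists2 S : {set vertices H}, indep_hg S &
    (#|W| <= #|S| + #|edges_in (edges H) W|)%N.
Proof.
move=> uH; have [k0|] := posnP #|W|.
  by exists set0; rewrite ?k0 //; apply: (small_indep_hg uH); rewrite cards0.
case/card_gt0P => w _.
pose g (e : {set vertices H}) := odflt w [pick x in e].
have gP e : e \in edges H -> g e \in e.
  move=> eE; rewrite /g; case: pickP => //= e0.
  by have := uniform_hgP uH eE; rewrite (eq_card0 e0).
pose F := [set g e | e in edges_in (edges H) W].
exists (W :\: F).
  apply/forallP => e; apply/implyP => eE; apply/negP => eW.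
  have := subsetP eW _ (gP _ eE); rewrite inE => /andP[/negP nF _].
  apply: nF; apply/imsetP; exists e => //; rewrite inE eE.
  by apply: subset_trans eW (subsetDl _ _).
apply: (@leq_trans (#|W :\: F| + #|F|)%N); last first.
  by rewrite leq_add2l leq_imset_card.
by rewrite -[X in (X <= _)%N](cardsID F W) addnC leq_add2l subset_leq_card // subsetIr.
Qed.

Lemma indep_powerset_le (H : hypergraph) (S : {set vertices H}) :
  indep_hg S -> (2 ^ #|S| <= num_indep_hg H)%N.
Proof.
move=> iS; rewrite -card_powerset; apply: subset_leq_card.
by apply/subsetP => T; rewrite !inE => TS; exact: indep_hgS iS.
Qed.

Lemma order_le_num_indep (k : nat) (H : hypergraph) :
  (0 < k)%N -> uniform_hg k.+1 H -> (order_hg H <= num_indep_hg H)%N.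
Proof.
move=> k0 uH; rewrite /order_hg -cardsT.
rewrite -(card_imset (f := @set1 (vertices H))); last exact: set1_inj.
apply: subset_leq_card; apply/subsetP => S /imsetP[x _ ->].
by rewrite inE (small_indep_hg uH) // cards1.
Qed.

Lemma num_indep_gt0 (k : nat) (H : hypergraph) :
  uniform_hg k.+1 H -> (0 < num_indep_hg H)%N.
Proof.
move=> uH; apply/card_gt0P; exists set0.
by rewrite inE (small_indep_hg uH) // cards0.
Qed.

(** * From good samples to the number of independent sets *)

Lemma avg_degree_le (R : realType) (r : nat) (H : hypergraph) (t : R) :
  (0 < order_hg H)%N ->
  (avg_degree_hg R r H <= t) = (r%:R * #|edges H|%:R <= t * (order_hg H)%:R).
Proof. by move=> n0; rewrite /avg_degree_hg ler_pdivrMr // ltr0n. Qed.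

Lemma card_draws_gt0 (V : finType) (m : nat) : (m <= #|V|)%N ->
  (0 < #|draws V m|)%N.
Proof. by move=> mV; rewrite /draws card_draws bin_gt0. Qed.

Lemma num_indep_ge_sampling (R : realType) (H : hypergraph) (m : nat)
    (G : {set {set vertices H}}) (y phi : R) :
  (0 < m <= order_hg H)%N -> G \subset draws (vertices H) m ->
  {in G, forall W : {set vertices H}, exists S : {set vertices H},
     [/\ indep_hg S, S \subset W & y <= #|S|%:R]} ->
  phi * #|draws (vertices H) m|%:R <= #|G|%:R ->
  phi * expR (y * ln ((order_hg H)%:R / m%:R)) <= (num_indep_hg H)%:R.
Proof.
case/andP => m0 mn Gm hG hphi; set n := order_hg H in mn *.
(* The double count needs one common integer size: round y up to the least integer a and shrink each
   independent set to size a. Since n / m >= 1, replacing y by a only raises the bound. *)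
have ex_a : exists a : nat, y <= a%:R.
  by exists (Num.truncn y).+1; apply/ltW; exact: truncnS_gt.
have [a ya amin] := ex_minnP ex_a.
have hI : {in G, forall W : {set vertices H},
    exists2 S, S \in [set S | indep_hg S] & (S \subset W) && (#|S| == a)}.
  move=> W WG; have [S [iS SW yS]] := hG W WG.
  have aS : (a <= #|S|)%N by exact: amin.
  have [T TS Ta] : exists2 T : {set vertices H}, T \subset S & #|T| = a.
    have : (0 < #|[set A : {set vertices H} | A \subset S & #|A| == a]|)%N.
      by rewrite cards_draws bin_gt0.
    by case/card_gt0P => T; rewrite inE => /andP[TS /eqP Ta]; exists T.
  exists T; first by rewrite inE (indep_hgS TS).
  by rewrite (subset_trans TS SW) Ta eqxx.
have := card_draws_le_indep mn Gm hI; rewrite -/(order_hg H) -/n -/(num_indep_hg H) -(ler_nat R).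
rewrite !natrM !natrX => le1.
have N0 : 0 < #|draws (vertices H) m|%:R :> R by rewrite ltr0n card_draws_gt0.
have mR0 : 0 < m%:R :> R by rewrite ltr0n.
have nR0 : 0 < n%:R :> R by rewrite ltr0n; lia.
have nm1 : 1 <= n%:R / m%:R :> R by rewrite ler_pdivlMr // mul1r ler_nat.
have nm0 : 0 < n%:R / m%:R :> R by exact: lt_le_trans ltr01 nm1.
have [phi0|phi0] := lerP phi 0.
  by apply: (@le_trans _ _ 0); rewrite // mulr_le0_ge0 // expR_ge0.
have -> : expR (y * ln (n%:R / m%:R)) = (n%:R / m%:R) `^ y :> R.
  by rewrite /powR gt_eqF.
apply: (@le_trans _ _ (phi * (n%:R / m%:R) ^+ a)).
  rewrite ler_pM2l // -powR_mulrn ?ler_powR //; exact: ltW.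
rewrite exprMn exprVn mulrA ler_pdivrMr ?exprn_gt0 // -(ler_pM2r N0) -!mulrA.
by apply: le_trans le1; rewrite mulrCA ler_pM2l ?exprn_gt0.
Qed.

(** * Fraction of samples of small average degree *)

(** With edges of size r and m > 0, the condition says that the subhypergraph induced on W has
    average degree at most s, cleared of its denominator. *)
Definition sparse_draws (R : realType) (V : finType) (E : {set {set V}})
    (r m : nat) (s : R) : {set {set V}} :=
  [set W in draws V m | r%:R * #|edges_in E W|%:R <= s * m%:R].

Lemma card_draws_sparseE (R : realType) (V : finType) (E : {set {set V}})
    (r m : nat) (s : R) :
  #|draws V m|%:R = #|sparse_draws E r m s|%:R
    + #|[set W in draws V m | s * m%:R < r%:R * #|edges_in E W|%:R]|%:R :> R.
Proof.
rewrite -natrD; congr _%:R; rewrite -[LHS](cardsID (sparse_draws E r m s)).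
congr (_ + _)%N; apply: eq_card => W; rewrite !inE.
  by rewrite andbA andbb.
by rewrite negb_and -ltNge; case: (#|W| == m) => //=; rewrite andbT.
Qed.

Lemma mean_edges_in_le (R : realType) (V : finType) (E : {set {set V}})
    (k m : nat) (t : R) :
  (0 < m <= #|V|)%N -> {in E, forall e : {set V}, #|e| = k.+1} ->
  k.+1%:R * #|E|%:R <= t * #|V|%:R ->
  k.+1%:R * \sum_(W in draws V m) #|edges_in E W|%:R
    <= t * (m%:R / #|V|%:R) ^+ k * m%:R * #|draws V m|%:R.
Proof.
case/andP => m0 mV Er ht.
have n0 : 0 < #|V|%:R :> R by rewrite ltr0n; lia.
have := sum_edges_in_le mV Er; rewrite -(ler_nat R) !natrM !natrX natr_sum => le1.
rewrite -(ler_pM2l (exprn_gt0 k.+1 n0)) mulrCA.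
apply: (le_trans (ler_wpM2l (ler0n _ _) le1)).
rewrite mulrA; apply: (le_trans (ler_wpM2r _ ht)).
  by rewrite mulr_ge0 ?exprn_ge0 ?ler0n.
rewrite le_eqVlt; apply/orP; left; apply/eqP.
rewrite expr_div_n !exprS; field.
by rewrite expf_neq0 // gt_eqF.
Qed.

Lemma sparse_draws_markov (R : realType) (V : finType) (E : {set {set V}})
    (k m : nat) (t s d : R) :
  (0 < m <= #|V|)%N -> {in E, forall e : {set V}, #|e| = k.+1} ->
  k.+1%:R * #|E|%:R <= t * #|V|%:R -> 0 < s ->
  t * (m%:R / #|V|%:R) ^+ k <= (1 - d) * s ->
  d * #|draws V m|%:R <= #|sparse_draws E k.+1 m s|%:R.
Proof.
move=> mV Er ht s0 hs; have le1 := mean_edges_in_le mV Er ht.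
have m0 : 0 < m%:R :> R by rewrite ltr0n; case/andP: mV.
have sm0 : 0 < s * m%:R by rewrite mulr_gt0.
have le2 : (s * m%:R) *
    #|[set W in draws V m | s * m%:R < k.+1%:R * #|edges_in E W|%:R]|%:R
    <= (1 - d) * (s * m%:R) * #|draws V m|%:R.
  apply: (@le_trans _ _ (k.+1%:R * \sum_(W in draws V m) #|edges_in E W|%:R)).
    rewrite mulr_sumr mulrC -sum1_card natr_sum mulr_suml.
    rewrite [X in _ <= X](bigID (fun W => W \in
      [set W in draws V m | s * m%:R < k.+1%:R * #|edges_in E W|%:R])) /=.
    rewrite -[X in X <= _]addr0; apply: lerD; last first.
      by apply: sumr_ge0 => W _; rewrite mulr_ge0 ?ler0n.
    rewrite [X in _ <= X](eq_bigl (fun W => W \in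
      [set W in draws V m | s * m%:R < k.+1%:R * #|edges_in E W|%:R])); last first.
      by move=> W; rewrite !inE; case: (#|W| == m).
    by apply: ler_sum => W; rewrite !inE mul1r => /andP[_ /ltW].
  apply: (le_trans le1); rewrite mulrA ler_wpM2r ?ler0n //.
  by rewrite ler_wpM2r ?ler0n.
have := card_draws_sparseE E k.+1 m s.
set N := #|draws V m|%:R; set g := #|sparse_draws _ _ _ _|%:R => EN.
move: le2; rewrite [(1 - d) * _]mulrC -[X in _ <= X]mulrA ler_pM2l // => le2.
by lra.
Qed.

(** The mean of (k+1) |E(W)| is at most (1 - d) s m, so a bad sample deviates by at least d s m. By
    [sum_sqr_edges_in_le] the variance is at most (k+1)^2 D s m, and the last hypothesis bounds the
    bad fraction (k+1)^2 D / (d^2 s m) by d. *)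
Lemma sparse_draws_chebyshev (R : realType) (V : finType) (E : {set {set V}})
    (k m D : nat) (t s d : R) :
  (0 < m <= #|V|)%N -> {in E, forall e : {set V}, #|e| = k.+1} ->
  k.+1%:R * #|E|%:R <= t * #|V|%:R -> 0 < s -> 0 < d ->
  t * (m%:R / #|V|%:R) ^+ k <= (1 - d) * s ->
  {in draws V m, forall (W : {set V}) v,
     #|[set e in edges_in E W | v \in e]| <= D}%N ->
  k.+1%:R ^+ 2 * D%:R <= d ^+ 3 * (s * m%:R) ->
  (1 - d) * #|draws V m|%:R <= #|sparse_draws E k.+1 m s|%:R.
Proof.
move=> mV Er ht s0 d0 hs hD hd; have le1 := mean_edges_in_le mV Er ht.
have [m0' mV'] := andP mV.
have m0 : 0 < m%:R :> R by rewrite ltr0n.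
have sm0 : 0 < s * m%:R by rewrite mulr_gt0.
have := sum_sqr_edges_in_le mV' Er hD.
rewrite -(ler_nat R) natrD natrX !natrM !natr_sum.
rewrite (eq_bigr (fun W => #|edges_in E W|%:R ^+ 2)); last by move=> W _; rewrite natrX.
set S1 := \sum_(W in _) _ in le1 *; set S2 := \sum_(W in _) _ => le2.
set N := #|draws V m|%:R in le1 le2 *.
have N0 : 0 < N by rewrite ltr0n card_draws_gt0.
set r := k.+1%:R in le1 le2 hd *.
have r0 : 0 < r by rewrite ltr0n.
have mean_le : r * S1 <= (1 - d) * (s * m%:R) * N.
  apply: (le_trans le1); rewrite ler_wpM2r ?ler0n // mulrA ler_wpM2r ?ler0n //.
set B := [set W in draws V m | s * m%:R < r * #|edges_in E W|%:R].
pose z (W : {set V}) : R := r * #|edges_in E W|%:R - r * S1 / N.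
have zB W : W \in B -> (d * (s * m%:R)) ^+ 2 <= z W ^+ 2.
  rewrite inE => /andP[_ hW].
  have lez : d * (s * m%:R) <= z W.
    rewrite /z lerBrDr -lerBrDl ler_pdivrMr //.
    by apply: (le_trans mean_le); rewrite ler_pM2r //; lra.
  by rewrite ler_pXn2r // nnegrE ?(le_trans _ lez) // ltW // mulr_gt0.
have sumz : \sum_(W in draws V m) z W ^+ 2 = r ^+ 2 * (S2 - S1 ^+ 2 / N).
  have -> : \sum_(W in draws V m) z W ^+ 2 = \sum_(W in draws V m)
     (r ^+ 2 * #|edges_in E W|%:R ^+ 2 -
      (2 * r ^+ 2 * S1 / N) * #|edges_in E W|%:R + r ^+ 2 * S1 ^+ 2 / N ^+ 2).
    by apply: eq_bigr => W _; rewrite /z; field; rewrite gt_eqF.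
  rewrite big_split sumrB /= -!mulr_sumr -/S1 -/S2 sumr_const -[_ *+ _]mulr_natr -/N.
  by field; rewrite gt_eqF.
have le3 : #|B|%:R * (d * (s * m%:R)) ^+ 2 <= \sum_(W in draws V m) z W ^+ 2.
  rewrite -sum1_card natr_sum mulr_suml.
  rewrite [X in _ <= X](bigID (fun W => W \in B)) /=.
  rewrite -[X in X <= _]addr0; apply: lerD; last first.
    by apply: sumr_ge0 => W _; rewrite sqr_ge0.
  rewrite [X in _ <= X](eq_bigl (fun W => W \in B)); last first.
    by move=> W; rewrite !inE; case: (#|W| == m).
  by apply: ler_sum => W WB; rewrite mul1r zB.
have le4 : \sum_(W in draws V m) z W ^+ 2 <= r ^+ 2 * D%:R * (r * S1).
  rewrite sumz -mulrA ler_pM2l ?exprn_gt0 // lerBlDr.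
  rewrite -(ler_pM2l N0) (le_trans le2) //.
  rewrite le_eqVlt; apply/orP; left; apply/eqP; field.
  by rewrite gt_eqF.
have S10 : 0 <= r * S1 by rewrite mulr_ge0 ?ler0n // /S1 sumr_ge0.
have le5 : r * S1 <= s * m%:R * N.
  apply: (le_trans mean_le); rewrite ler_pM2r // ger_pMl //; lra.
have le6 : #|B|%:R * (d * (s * m%:R)) ^+ 2 <= d ^+ 3 * (s * m%:R) * (s * m%:R * N).
  apply: (le_trans le3); apply: (le_trans le4).
  by apply: ler_pM => //; rewrite mulr_ge0 ?ler0n ?sqr_ge0.
have le7 : #|B|%:R <= d * N.
  have p0 : 0 < (d * (s * m%:R)) ^+ 2 by rewrite exprn_gt0 // mulr_gt0.
  rewrite -(ler_pM2r p0); apply: (le_trans le6).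
  by rewrite le_eqVlt; apply/orP; left; apply/eqP; ring.
have := card_draws_sparseE E k.+1 m s; rewrite -/N -/r -/B.
set g := #|sparse_draws _ _ _ _|%:R => EN; rewrite mulrBl mul1r; lra.
Qed.

(** * Lower bound by deletion, independent of [f] *)

Lemma num_indep_ge_deletion (k : nat) (H : hypergraph) (W : {set vertices H}) :
  uniform_hg k.+1 H ->
  exists2 a : nat, (#|W| <= a + #|edges_in (edges H) W|)%N &
    (2 ^ a <= num_indep_hg H)%N.
Proof.
move=> uH; have [S iS hS] := indep_deletion W uH.
by exists #|S| => //; exact: indep_powerset_le.
Qed.

Lemma expR_half_le2 (R : realType) : expR (1 / 2) <= 2 :> R.
Proof.
have h : 1 + - (1 / 2) <= expR (- (1 / 2)) :> R by exact: expR_ge1Dx.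
have p : 0 < expR (1 / 2) :> R by exact: expR_gt0.
move: h; rewrite expRN => h.
have e1 : expR (1 / 2) * (expR (1 / 2))^-1 = 1 :> R by rewrite mulfV // gt_eqF.
have := ler_wpM2l (ltW p) h; rewrite e1; lra.
Qed.

(** The 8 is a product of three halvings: rounding n / t^(1/k) down to m, keeping m / 2 vertices
    after deletion, and using e^(1/2) <= 2. *)
Lemma num_indep_ge_weak (R : realType) (k : nat) (H : hypergraph) (t : R) :
  (0 < k)%N -> uniform_hg k.+1 H -> 1 <= t -> avg_degree_hg R k.+1 H <= t ->
  t < (order_hg H)%:R ^+ k ->
  expR ((order_hg H)%:R / t `^ (1 / k%:R) / 8) <= (num_indep_hg H)%:R.
Proof.
move=> k0 uH t1 ht tn; set n := order_hg H in ht tn *.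
have n0 : (0 < n)%N.
  case: (posnP n) => // n0; move: tn.
  by rewrite n0 expr0n eqn0Ngt k0 /=; lra.
have t0 : 0 < t by lra.
have kR0 : 0 < k%:R :> R by rewrite ltr0n.
move: ht; rewrite avg_degree_le // => ht.
set u := t `^ (1 / k%:R).
have u0 : 0 < u by exact: powR_gt0.
have uk : u ^+ k = t.
  by rewrite -powR_mulrn ?ltW // -powRrM mul1r mulVf ?gt_eqF // powRr1 // ltW.
have u1 : 1 <= u.
  rewrite leNgt; apply/negP => u1.
  have : u ^+ k < 1 by rewrite exprn_ilt1 ?(ltW u0) // -lt0n.
  by rewrite uk; lra.
have un : u < n%:R by rewrite -(ltr_pXn2r k0) ?nnegrE ?ler0n ?(ltW u0) // uk.
have nR0 : 0 < n%:R :> R by rewrite ltr0n.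
(* At this size the mean of the sampled average degree is at most 1, so some sample W has at most m
   / (k+1) <= m / 2 edges. *)
set m := Num.truncn (n%:R / u).
have mle : m%:R <= n%:R / u by rewrite truncn_le // divr_ge0 // ltW.
have mgt : n%:R / u < m%:R + 1 by rewrite natr1 truncnS_gt.
have nu1 : 1 < n%:R / u by rewrite ltr_pdivlMr // mul1r.
have m0 : (0 < m)%N by rewrite -(ltr0n R); lra.
have mn : (m <= n)%N.
  rewrite -(ler_nat R); apply: (le_trans mle).
  by rewrite ler_pdivrMr // ler_peMr // ltW.
have mV : (0 < m <= #|vertices H|)%N by rewrite m0.
have hs : t * (m%:R / n%:R) ^+ k <= (1 - 0) * 1.
  rewrite subr0 mulr1 -uk -exprMn exprn_ile1 //.
    by rewrite mulr_ge0 ?divr_ge0 ?ler0n ?ltW.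
  by rewrite mulrA ler_pdivrMr // mul1r mulrC -ler_pdivlMr.
have [W Wm hW] : exists2 W : {set vertices H}, #|W| = m &
    k.+1%:R * #|edges_in (edges H) W|%:R <= m%:R :> R.
  have le1 := mean_edges_in_le mV (uniform_hgP uH) ht.
  apply: contrapT => nex.
  have gt1 (W : {set vertices H}) : W \in draws (vertices H) m ->
      m%:R < k.+1%:R * #|edges_in (edges H) W|%:R :> R.
    rewrite inE => /eqP Wm; rewrite ltNge; apply/negP => hW; apply: nex.
    by exists W.
  have [W0 W0m] : exists W, W \in draws (vertices H) m.
    by apply/card_gt0P; rewrite card_draws_gt0.
  have : m%:R * #|draws (vertices H) m|%:R < k.+1%:R *
      \sum_(W in draws (vertices H) m) #|edges_in (edges H) W|%:R :> R.
    rewrite mulr_sumr mulr_natr -sumr_const.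
    rewrite (bigD1 W0) //= [X in _ < X](bigD1 W0) //=.
    apply: ltr_leD; first exact: gt1.
    by apply: ler_sum => W /andP[Wm _]; exact/ltW/gt1.
  apply/negP; rewrite -leNgt; apply: (le_trans le1).
  rewrite ler_wpM2r ?ler0n // -[X in _ <= X]mul1r ler_wpM2r ?ler0n //.
  by move: hs; rewrite subr0 mulr1.
have [a ha hi] := num_indep_ge_deletion W uH.
have ha2 : (m <= 2 * a)%N.
  move: hW; rewrite -natrM ler_nat => hW; rewrite Wm in ha; nia.
apply: (@le_trans _ _ (2 ^+ a)); last by rewrite -natrX ler_nat.
apply: (@le_trans _ _ (expR (1 / 2) ^+ a)); last first.
  by rewrite lerXn2r ?nnegrE ?expR_ge0 // expR_half_le2.
rewrite -expRM_natl ler_expR.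
have : m%:R <= 2 * a%:R :> R by rewrite -natrM ler_nat.
have : 1 <= m%:R :> R by rewrite ler1n.
lra.
Qed.

(** * Counting with a sample of proportion t^(-c) *)

(** The factor 1 - d leaves room below s for Markov or Chebyshev; truncation then loses at most 1 <=
    d y, whence 1 - 2d. *)
Lemma sample_size (R : realType) (n : nat) (y d : R) :
  0 < d -> d <= 1 / 4 -> 1 <= d * y -> y <= n%:R ->
  exists m : nat, [/\ (0 < m <= n)%N, (1 - 2 * d) * y <= m%:R
    & m%:R <= (1 - d) * y].
Proof.
move=> d0 d4 dy yn; have y0 : 0 < y by nra.
have z0 : 0 <= (1 - d) * y by nra.
exists (Num.truncn ((1 - d) * y)); set m := Num.truncn _.
have mle : m%:R <= (1 - d) * y by rewrite truncn_le.
have mgt : (1 - d) * y < m%:R + 1 by rewrite natr1 truncnS_gt.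
split=> //; last by nra.
apply/andP; split; first by rewrite -(ltr0n R); nra.
by rewrite -(ler_nat R); nra.
Qed.

(* The sampled fraction of the vertices is about t ^ (-c), so that the average
   degree drops to s = t ^ (1 - k c) and each vertex of an independent set of
   the sample contributes a factor t ^ c to the count. *)
Definition exponent_hg (R : realType) (k n : nat) (f : R -> R) (t c : R) : R :=
  n%:R / t `^ (1 / k%:R) * f (t `^ (1 - k%:R * c)) * (c * ln t).

Lemma powRD_gt0 (R : realType) (x a b : R) : 0 < x ->
  x `^ (a + b) = x `^ a * x `^ b.
Proof. by move=> x0; rewrite powRD //; apply/implyP => _; rewrite gt_eqF. Qed.

(** Sampling preserves the scale: s^(1/k) = t^(1/k) t^(-c), so m / s^(1/k) >= (1 - 2d) n / t^(1/k),
    while n / m >= t^c supplies the factor c ln t. *)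
Lemma num_indep_ge_fraction (R : realType) (k : nat) (P : hypergraph -> Prop)
    (f : R -> R) (H : hypergraph) (t c d phi : R) (m : nat) :
  (0 < k)%N -> hereditary_hg P ->
  (forall (H : hypergraph) (t : R),
     P H -> uniform_hg k.+1 H -> 0 < t -> avg_degree_hg R k.+1 H <= t ->
     (order_hg H)%:R / t `^ (1 / k%:R) * f t <= (alpha_hg H)%:R) ->
  P H -> uniform_hg k.+1 H -> 1 < t -> 0 <= c ->
  0 <= f (t `^ (1 - k%:R * c)) -> d <= 1 / 2 -> 0 <= phi ->
  (0 < m <= order_hg H)%N ->
  (1 - 2 * d) * ((order_hg H)%:R * t `^ (- c)) <= m%:R ->
  m%:R <= (order_hg H)%:R * t `^ (- c) ->
  phi * #|draws (vertices H) m|%:R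
    <= #|sparse_draws (edges H) k.+1 m (t `^ (1 - k%:R * c))|%:R ->
  phi * expR ((1 - 2 * d) * exponent_hg k (order_hg H) f t c)
    <= (num_indep_hg H)%:R.
Proof.
move=> k0 hP hf PH uH t1 c0; set s := t `^ (1 - _) => fs0 d2 phi0 mn hm1 hm2 hphi.
set n := order_hg H in mn hm1 hm2 *.
have t0 : 0 < t by lra.
have s0 : 0 < s by exact: powR_gt0.
have kR0 : 0 < k%:R :> R by rewrite ltr0n.
have m0 : 0 < m%:R :> R by rewrite ltr0n; case/andP: mn.
have nR0 : 0 < n%:R :> R by rewrite ltr0n; lia.
have tc0 : 0 < t `^ (- c) by exact: powR_gt0.
pose y := m%:R / s `^ (1 / k%:R) * f s.
apply: le_trans (@num_indep_ge_sampling R H m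
  (sparse_draws (edges H) k.+1 m s) y phi mn _ _ hphi); last first.
- move=> W; rewrite inE => /andP[]; rewrite inE => /eqP Wm hW.
  have [S [iS SW cS]] := alpha_induced_hgP W uH.
  exists S; split=> //; rewrite cS /y -Wm -(order_induced_hg W).
  apply: hf => //; first exact: hP.
    exact: uniform_induced_hg.
  rewrite avg_degree_le order_induced_hg ?Wm; last by case/andP: mn.
  by rewrite card_edges_induced_hg.
- by apply/subsetP => W; rewrite inE => /andP[].
rewrite ler_wpM2l // ler_expR -/n /y /exponent_hg -/s.
have u0 : 0 < t `^ (1 / k%:R) by exact: powR_gt0.
have su : s `^ (1 / k%:R) = t `^ (1 / k%:R) * t `^ (- c).
  rewrite /s -powRrM -powRD_gt0 //; congr (_ `^ _); field.
  by rewrite gt_eqF.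
rewrite !mulrA -[X in X <= _]mulrA; apply: ler_pM.
- rewrite mulr_ge0 // -mulrA mulr_ge0 //; first by lra.
  by rewrite divr_ge0 // ltW.
- by rewrite mulr_ge0 // ln_ge0 // ltW.
- rewrite ler_wpM2r // su.
  have -> : (1 - 2 * d) * n%:R / t `^ (1 / k%:R) = (1 - 2 * d) *
      (n%:R * t `^ (- c)) / (t `^ (1 / k%:R) * t `^ (- c)).
    by field; rewrite !gt_eqF.
  by rewrite ler_pM2r // invr_gt0 mulr_gt0.
- rewrite -ln_powR ler_ln ?posrE ?powR_gt0 ?divr_gt0 // ler_pdivlMr //.
  rewrite mulrC -ler_pdivlMr ?powR_gt0 // -powRN //.
Qed.

Lemma mean_scale_le (R : realType) (k n m : nat) (t c d : R) :
  (0 < k)%N -> (0 < n)%N -> 0 < t -> 0 <= d <= 1 ->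
  m%:R <= (1 - d) * (n%:R * t `^ (- c)) ->
  t * (m%:R / n%:R) ^+ k <= (1 - d) * t `^ (1 - k%:R * c).
Proof.
move=> k0 n0 t0 /andP[d0 d1] hm.
have nR0 : 0 < n%:R :> R by rewrite ltr0n.
have h : m%:R / n%:R <= (1 - d) * t `^ (- c).
  by rewrite ler_pdivrMr // -mulrA [_ * n%:R]mulrC.
have tc0 : 0 < t `^ (- c) by exact: powR_gt0.
apply: (@le_trans _ _ (t * ((1 - d) * t `^ (- c)) ^+ k)).
  rewrite ler_pM2l // lerXn2r // nnegrE ?divr_ge0 //.
  by rewrite mulr_ge0 ?(ltW tc0) //; lra.
have -> : t `^ (1 - k%:R * c) = t * t `^ (- c) ^+ k.
  rewrite powRD_gt0 // powRr1 ?ltW // -powR_mulrn ?ltW // -powRrM.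
  by congr (_ * _ `^ _); ring.
rewrite exprMn mulrCA ler_pM2r ?mulr_gt0 ?exprn_gt0 //.
case: k k0 => // k _; rewrite exprS ler_piMr ?exprn_ile1 //; lra.
Qed.

(** Here phi = d, and the last hypothesis pays for it with 2 d X, which turns 1 - 2d into 1 - 4d. *)
Lemma num_indep_ge_markov (R : realType) (k : nat) (P : hypergraph -> Prop)
    (f : R -> R) (H : hypergraph) (t c d : R) :
  (0 < k)%N -> hereditary_hg P ->
  (forall (H : hypergraph) (t : R),
     P H -> uniform_hg k.+1 H -> 0 < t -> avg_degree_hg R k.+1 H <= t ->
     (order_hg H)%:R / t `^ (1 / k%:R) * f t <= (alpha_hg H)%:R) ->
  P H -> uniform_hg k.+1 H -> avg_degree_hg R k.+1 H <= t ->
  1 < t -> 0 <= c -> 0 <= f (t `^ (1 - k%:R * c)) ->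
  0 < d -> d <= 1 / 4 -> 1 <= d * ((order_hg H)%:R * t `^ (- c)) ->
  d^-1 <= expR (2 * d * exponent_hg k (order_hg H) f t c) ->
  expR ((1 - 4 * d) * exponent_hg k (order_hg H) f t c)
    <= (num_indep_hg H)%:R.
Proof.
move=> k0 hP hf PH uH ht t1 c0 fs0 d0 d4 dn hd.
set n := order_hg H in ht dn hd *.
have t0 : 0 < t by lra.
have tc0 : 0 < t `^ (- c) by exact: powR_gt0.
have n0 : (0 < n)%N.
  by case: (posnP n) dn => // ->; rewrite mul0r mulr0; lra.
have nR0 : 0 < n%:R :> R by rewrite ltr0n.
have tc1 : t `^ (- c) <= 1.
  by rewrite -[X in _ <= X](powRr0 t) ler_powR ?oppr_le0 // ltW.
have [|m [mn hm1 hm2]] := @sample_size R n _ d d0 d4 dn.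
  by rewrite ler_piMr // ltW.
have hm3 : m%:R <= n%:R * t `^ (- c).
  by apply: (le_trans hm2); rewrite ger_pMl ?mulr_gt0 //; lra.
have d01 : 0 <= d <= 1 by apply/andP; split; lra.
have hs := mean_scale_le k0 n0 t0 d01 hm2.
move: ht; rewrite avg_degree_le // => ht.
have hG := sparse_draws_markov mn (uniform_hgP uH) ht (powR_gt0 _ t0) hs.
have d2 : d <= 1 / 2 by lra.
apply: le_trans (num_indep_ge_fraction k0 hP hf PH uH t1 c0 fs0 d2 (ltW d0) mn hm1 hm3 hG).
rewrite -/n; set X := exponent_hg _ _ _ _ _ in hd *.
have -> : (1 - 4 * d) * X = (1 - 2 * d) * X - 2 * d * X by ring.
rewrite expRD mulrC expRN ler_pM2r ?expR_gt0 //.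
by rewrite -[X in _ <= X]invrK lef_pV2 // posrE ?expR_gt0 ?invr_gt0.
Qed.

Lemma num_indep_ge_chebyshev (R : realType) (k : nat) (P : hypergraph -> Prop)
    (f : R -> R) (H : hypergraph) (D : nat -> nat) (t c d : R) :
  (0 < k)%N -> hereditary_hg P ->
  (forall (H : hypergraph) (t : R),
     P H -> uniform_hg k.+1 H -> 0 < t -> avg_degree_hg R k.+1 H <= t ->
     (order_hg H)%:R / t `^ (1 / k%:R) * f t <= (alpha_hg H)%:R) ->
  P H -> uniform_hg k.+1 H -> avg_degree_hg R k.+1 H <= t ->
  1 < t -> 0 <= c -> 0 <= f (t `^ (1 - k%:R * c)) ->
  0 < d -> d <= 1 / 4 -> 1 <= d * ((order_hg H)%:R * t `^ (- c)) ->
  (forall (W : {set vertices H}) v,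
     #|[set e in edges_in (edges H) W | v \in e]| <= D #|W|)%N ->
  (forall m : nat, (0 < m)%N -> m%:R <= (order_hg H)%:R * t `^ (- c) ->
     k.+1%:R ^+ 2 * (D m)%:R <= d ^+ 3 * (t `^ (1 - k%:R * c) * m%:R)) ->
  1 <= exponent_hg k (order_hg H) f t c ->
  expR ((1 - 4 * d) * exponent_hg k (order_hg H) f t c)
    <= (num_indep_hg H)%:R.
Proof.
move=> k0 hP hf PH uH ht t1 c0 fs0 d0 d4 dn hD hd X1.
set n := order_hg H in ht dn hd X1 *.
have t0 : 0 < t by lra.
have tc0 : 0 < t `^ (- c) by exact: powR_gt0.
have n0 : (0 < n)%N.
  by case: (posnP n) dn => // ->; rewrite mul0r mulr0; lra.
have nR0 : 0 < n%:R :> R by rewrite ltr0n.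
have tc1 : t `^ (- c) <= 1.
  by rewrite -[X in _ <= X](powRr0 t) ler_powR ?oppr_le0 // ltW.
have [|m [mn hm1 hm2]] := @sample_size R n _ d d0 d4 dn.
  by rewrite ler_piMr // ltW.
have hm3 : m%:R <= n%:R * t `^ (- c).
  by apply: (le_trans hm2); rewrite ger_pMl ?mulr_gt0 //; lra.
have d01 : 0 <= d <= 1 by apply/andP; split; lra.
have hs := mean_scale_le k0 n0 t0 d01 hm2.
move: ht; rewrite avg_degree_le // => ht.
have m0 : (0 < m)%N by case/andP: mn.
have hD' : {in draws (vertices H) m, forall (W : {set vertices H}) v,
    #|[set e in edges_in (edges H) W | v \in e]| <= D m}%N.
  by move=> W; rewrite inE => /eqP <-.
have hG := sparse_draws_chebyshev mn (uniform_hgP uH) ht (powR_gt0 _ t0) d0 hs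
  hD' (hd m m0 hm3).
have d2 : d <= 1 / 2 by lra.
have phi0 : 0 <= 1 - d by lra.
apply: le_trans (num_indep_ge_fraction k0 hP hf PH uH t1 c0 fs0 d2 phi0 mn hm1 hm3 hG).
rewrite -/n; set X := exponent_hg _ _ _ _ _ in X1 *.
have -> : (1 - 4 * d) * X = (1 - 2 * d) * X - 2 * d * X by ring.
rewrite expRD mulrC ler_pM2r ?expR_gt0 //.
(* As X >= 1, it suffices that e^(-2d) <= 1 - d, which follows from (1 - d) (1 + 2d) >= 1 for d <=
   1/2. *)
apply: (@le_trans _ _ (expR (- (2 * d)))); first by rewrite ler_expR; nra.
rewrite expRN; have := expR_ge1Dx (2 * d) => h.
rewrite -div1r ler_pdivrMr ?expR_gt0 //.
by apply: le_trans (ler_wpM2l phi0 h); nra.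
Qed.

(** * Choice of d and the split on the size of t *)

Lemma natr_powR_unbounded (R : realType) (a C : R) : 0 < a ->
  exists n0 : nat, forall n : nat, (n0 <= n)%N -> C <= n%:R `^ a.
Proof.
move=> a0; set x := (`|C| + 1) `^ a^-1.
exists (Num.truncn x).+1 => n hn.
have x0 : 0 <= x by exact: powR_ge0.
have xn : x <= n%:R.
  by apply: (@le_trans _ _ (Num.truncn x).+1%:R); rewrite ?ler_nat // ltW ?truncnS_gt.
have C0 : 0 <= `|C| by [].
apply: (@le_trans _ _ (x `^ a)); last first.
  by rewrite ge0_ler_powR ?nnegrE // ltW.
rewrite /x -powRrM mulVf ?gt_eqF // powRr1 ?addr_ge0 //.
by apply: (le_trans (ler_norm C)); rewrite lerDl.
Qed.

(* Markov costs a term ln (1 / d), which is affordable only when the exponent is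
   a power of n; otherwise t is close to n ^ k and Chebyshev applies. *)
Lemma num_indep_ge_main (R : realType) (k : nat) (eps c : R)
    (P : hypergraph -> Prop) (f : R -> R) (H : hypergraph) (D : nat -> nat)
    (t : R) :
  (0 < k)%N -> 0 < eps -> hereditary_hg P ->
  (forall (H : hypergraph) (t : R),
     P H -> uniform_hg k.+1 H -> 0 < t -> avg_degree_hg R k.+1 H <= t ->
     (order_hg H)%:R / t `^ (1 / k%:R) * f t <= (alpha_hg H)%:R) ->
  P H -> uniform_hg k.+1 H -> avg_degree_hg R k.+1 H <= t ->
  1 < t -> t < (order_hg H)%:R ^+ k -> 0 <= c ->
  0 <= f (t `^ (1 - k%:R * c)) -> (4 <= order_hg H)%N ->
  704 <= (order_hg H)%:R `^ (eps / 840) ->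
  4 <= (order_hg H)%:R `^ (1 - k%:R * c - eps / 21) ->
  (forall (W : {set vertices H}) v,
     #|[set e in edges_in (edges H) W | v \in e]| <= D #|W|)%N ->
  ((order_hg H)%:R `^ (k%:R * (1 - eps / 20)) <= t ->
   forall m : nat, (0 < m)%N -> m%:R <= (order_hg H)%:R * t `^ (- c) ->
     64 * k.+1%:R ^+ 2 * (D m)%:R
       <= (order_hg H)%:R `^ (- (eps / 7)) * (t `^ (1 - k%:R * c) * m%:R)) ->
  expR ((1 - (order_hg H)%:R `^ (- (eps / 21)))
        * exponent_hg k (order_hg H) f t c)
    <= (num_indep_hg H)%:R.
Proof.
move=> k0 e0 hP hf PH uH ht t1 tn c0 fs0 n4 hn2 hn3 hD hcheb.
set n := order_hg H in ht tn n4 hn2 hn3 hcheb *.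
have t0 : 0 < t by lra.
have nR4 : 4 <= n%:R :> R by rewrite (ler_nat R 4).
have nR0 : 0 < n%:R :> R by lra.
have nR1 : 1 <= n%:R :> R by lra.
have kR0 : 0 < k%:R :> R by rewrite ltr0n.
(* Both sampling bounds lose a factor 1 - 4d, so d = q / 4 gives exactly 1 - n^(-eps/21). *)
set q := n%:R `^ (- (eps / 21)); pose d : R := q / 4.
have q0 : 0 < q by exact: powR_gt0.
have q1 : q <= 1.
  by rewrite -[X in _ <= X](powRr0 n%:R) ler_powR // oppr_le0 divr_ge0 // ltW.
have d0 : 0 < d by rewrite /d; lra.
have d4 : d <= 1 / 4 by rewrite /d; lra.
have Ed : 1 - q = 1 - 4 * d by rewrite /d; field.
rewrite Ed.
have u0 : 0 < t `^ (1 / k%:R) by exact: powR_gt0.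
have lnt0 : 0 <= ln t by rewrite ln_ge0 // ltW.
set X := exponent_hg k n f t c.
have X0 : 0 <= X.
  apply: mulr_ge0; last exact: mulr_ge0.
  by apply: mulr_ge0 => //; rewrite divr_ge0 // ltW.
have dn : 1 <= d * (n%:R * t `^ (- c)).
  have tc : n%:R `^ (- (k%:R * c)) <= t `^ (- c).
    rewrite !powRN lef_pV2 ?posrE ?powR_gt0 // powRrM powR_mulrn ?ler0n //.
    by rewrite ge0_ler_powR ?nnegrE ?exprn_ge0 ?ler0n ?(ltW t0) ?(ltW tn).
  have E : n%:R `^ (1 - k%:R * c - eps / 21) = q * (n%:R * n%:R `^ (- (k%:R * c))).
    rewrite addrC powRD_gt0 // powRD_gt0 // powRr1 //; exact: ltW.
  have : q * (n%:R * n%:R `^ (- (k%:R * c))) <= q * (n%:R * t `^ (- c)).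
    by rewrite !ler_pM2l.
  by rewrite -E /d; lra.
have [tsmall|tlarge] := ltP t (n%:R `^ (k%:R * (1 - eps / 20))).
- have weak := num_indep_ge_weak k0 uH (ltW t1) ht tn.
  rewrite -/n in weak.
  have [Xw|Xw] := lerP X (n%:R / t `^ (1 / k%:R) / 8).
    apply: le_trans weak; rewrite ler_expR; apply: le_trans Xw.
    by rewrite ler_piMl //; lra.
  apply: (num_indep_ge_markov k0 hP hf PH uH ht) => //.
  (* As 840 = 21 * 40 = 20 * 42, one has n^(eps/21) = y^40 and n^(eps/20) = y^42. Thus 1/d = 4 y^40
     and 2 d X >= y^2 / 16, which is at least 44 y because y >= 704 = 16 * 44; and 4 y^40 <= e^(4y)
     e^(40y). *)
  rewrite -/n -/X; pose y := n%:R `^ (eps / 840).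
  have y0 : 704 <= y by [].
  have yn (j : nat) : y ^+ j = n%:R `^ (eps / 840 * j%:R).
    by rewrite -powR_mulrn ?powR_ge0 // -powRrM.
  have Edi : d^-1 = 4 * y ^+ 40.
    by rewrite /d invf_div /q powRN invrK yn; congr (_ * _ `^ _); field.
  have nu : n%:R `^ (eps / 20) <= n%:R / t `^ (1 / k%:R).
    rewrite ler_pdivlMr //.
    have ut : t `^ (1 / k%:R) <= n%:R `^ (1 - eps / 20).
      have -> : 1 - eps / 20 = k%:R * (1 - eps / 20) * (1 / k%:R).
        by field; rewrite gt_eqF.
      rewrite [X in _ <= X]powRrM; apply: ge0_ler_powR.
      - by rewrite divr_ge0 // ltW.
      - by rewrite nnegrE ltW.
      - by rewrite nnegrE powR_ge0.
      - exact: ltW.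
    apply: le_trans (ler_wpM2l (powR_ge0 _ _) ut) _.
    by rewrite -powRD_gt0 // addrC subrK powRr1 // ltW.
  have dX : y ^+ 2 / 16 <= 2 * d * X.
    have -> : y ^+ 2 = q * n%:R `^ (eps / 20).
      by rewrite yn /q -powRD_gt0 //; congr (_ `^ _); field.
    have : q * n%:R `^ (eps / 20) <= q * (8 * X).
      rewrite ler_pM2l //; lra.
    rewrite /d; lra.
  rewrite Edi; apply: (@le_trans _ _ (expR (44 * y))); last first.
    by rewrite ler_expR; apply: le_trans dX; nra.
  have -> : 44 * y = 4 * y + 40%:R * y by ring.
  rewrite expRD ler_pM ?exprn_ge0 //; try lra.
    by have := expR_ge1Dx (4 * y); lra.
  rewrite expRM_natl lerXn2r ?nnegrE ?expR_ge0 //; first lra.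
  by have := expR_ge1Dx y; lra.
(* If X < 1 the target is at most e <= 4 <= n, and the singletons alone are n independent sets. *)
- have [X1|X1] := ltP X 1.
    apply: (@le_trans _ _ n%:R); last by rewrite ler_nat (order_le_num_indep k0 uH).
    apply: le_trans nR4; apply: (@le_trans _ _ (expR (1 / 2) ^+ 2)).
      by rewrite -expRM_natl ler_expR; nra.
    have := expR_half_le2 R; have := expR_ge0 (1 / 2 : R); nra.
  apply: (num_indep_ge_chebyshev k0 hP hf PH uH ht) hD _ _ => //.
  move=> m m0 hm; have := hcheb tlarge m m0 hm.
  have -> : d ^+ 3 = n%:R `^ (- (eps / 7)) / 64.
    have -> : n%:R `^ (- (eps / 7)) = q ^+ 3.
      by rewrite /q -powR_mulrn ?powR_ge0 // -powRrM; congr (_ `^ _); field.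
    by rewrite /d; field.
  by lra.
Qed.

(** * The range t <= 1 and the final case analysis *)

Lemma linear_uniform2 (H : hypergraph) : uniform_hg 2 H -> linear_hg H.
Proof.
move=> /uniform_hgP u; apply/forallP => e1; apply/implyP => E1.
apply/forallP => e2; apply/implyP => E2; apply/implyP; apply: contraNT.
rewrite -ltnNge => h.
have s12 : e1 :&: e2 = e1 by apply/eqP; rewrite eqEcard subsetIl u.
have s21 : e1 :&: e2 = e2 by apply/eqP; rewrite eqEcard subsetIr u.
by rewrite -s12 {1}s21.
Qed.

Lemma linear_hgP (H : hypergraph) : linear_hg H ->
  {in edges H &, forall e1 e2 : {set vertices H},
     e1 != e2 -> #|e1 :&: e2| <= 1}%N.
Proof.
move=> lin e1 e2 E1 E2 ne.
by move: lin => /forallP/(_ e1)/implyP/(_ E1)/forallP/(_ e2)/implyP/(_ E2)/implyP; exact.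
Qed.

(** Apply the hypothesis on [f] to a single induced vertex: it has no edge, since k > 0, and
    independence number at most 1. *)
Lemma hereditary_bound_le (R : realType) (k : nat) (P : hypergraph -> Prop)
    (f : R -> R) (H : hypergraph) (s : R) :
  (0 < k)%N -> hereditary_hg P ->
  (forall (H : hypergraph) (t : R),
     P H -> uniform_hg k.+1 H -> 0 < t -> avg_degree_hg R k.+1 H <= t ->
     (order_hg H)%:R / t `^ (1 / k%:R) * f t <= (alpha_hg H)%:R) ->
  P H -> uniform_hg k.+1 H -> (0 < order_hg H)%N -> 0 < s ->
  f s <= s `^ (1 / k%:R).
Proof.
move=> k0 hP hf PH uH /card_gt0P[x _] s0.
pose W : {set vertices H} := [set x].
have E0 : edges (induced_hg W) = set0.
  apply/eqP; rewrite -cards_eq0 card_edges_induced_hg cards_eq0 -subset0.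
  apply/subsetP => e; rewrite inE => /andP[eE /subset_leq_card].
  by rewrite cards1 (uniform_hgP uH) // ltnS leqNgt k0.
have := hf (induced_hg W) s (hP _ _ PH) (uniform_induced_hg W uH) s0.
rewrite /avg_degree_hg E0 cards0 mulr0 mul0r => /(_ (ltW s0)).
rewrite order_induced_hg cards1 => le1.
have [S [_ /subset_leq_card]] := alpha_induced_hgP W uH; rewrite cards1 => S1 ES.
have u0 : 0 < s `^ (1 / k%:R) by exact: powR_gt0.
have : 1 / s `^ (1 / k%:R) * f s <= 1.
  by apply: (le_trans le1); rewrite -ES lern1.
by rewrite mulrAC ler_pdivrMr // !mul1r.
Qed.

(** From 1 - x <= e^(-x) at x = 1.26 / 16, followed by four squarings. Here 1.26 is three times the
    0.42 of [num_indep_ge_sparse]. *)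
Lemma expR_le4 (R : realType) : expR (126 / 100) <= 4 :> R.
Proof.
pose v : R := expR (- (126 / 1600)).
have v1 : 1474 / 1600 <= v.
  by have := expR_ge1Dx (- (126 / 1600) : R); rewrite /v; lra.
have v16 : v ^+ 16 = (expR (126 / 100))^-1.
  by rewrite /v -expRM_natl -expRN; congr expR; field.
have v2 : 848 / 1000 <= v ^+ 2 by nra.
have v4 : 719 / 1000 <= v ^+ 4 by rewrite (exprM v 2 2); nra.
have v8 : 516 / 1000 <= v ^+ 8 by rewrite (exprM v 4 2); nra.
have : 1 / 4 <= v ^+ 16 by rewrite (exprM v 8 2); nra.
by rewrite v16 div1r lef_pV2 // posrE ?expR_gt0.
Qed.

(** For k >= 2 there are at most n / 3 edges. Cubing avoids the fractional exponent: 2^(3a) >= 4^n.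
    The 0.42 is a rational between 1/e and (2/3) ln 2. *)
Lemma num_indep_ge_sparse (R : realType) (k : nat) (H : hypergraph) (t : R) :
  (1 < k)%N -> uniform_hg k.+1 H -> (0 < order_hg H)%N ->
  avg_degree_hg R k.+1 H <= t -> t <= 1 ->
  expR (42 / 100 * (order_hg H)%:R) <= (num_indep_hg H)%:R :> R.
Proof.
move=> k1 uH n0; rewrite avg_degree_le // => ht t1.
set n := order_hg H in n0 ht *.
have [a ha hi] := num_indep_ge_deletion [set: vertices H] uH.
have cE : (k.+1 * #|edges H| <= n)%N.
  rewrite -(ler_nat R) natrM; apply: (le_trans ht).
  by rewrite ler_piMl.
have ha3 : (2 * n <= 3 * a)%N.
  move: ha; rewrite cardsT -/(order_hg H) -/n => ha.
  have : (#|edges_in (edges H) [set: vertices H]| <= #|edges H|)%N.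
    by apply: subset_leq_card; apply/subsetP => e; rewrite inE => /andP[].
  nia.
rewrite -(ler_pXn2r (isT : (0 < 3)%N)) ?nnegrE ?expR_ge0 //.
apply: (@le_trans _ _ (4 ^+ n)).
  rewrite -expRM_natl (_ : 3%:R * (42 / 100 * n%:R) = n%:R * (126 / 100)); last by field.
  by rewrite expRM_natl lerXn2r ?nnegrE ?expR_ge0 // expR_le4.
have -> : 4 = (2 ^ 2)%:R :> R by [].
rewrite -!natrX ler_nat -expnM; apply: (@leq_trans ((2 ^ a) ^ 3)).
  by rewrite -expnM leq_exp2l // [(a * 3)%N]mulnC.
by rewrite leq_exp2r.
Qed.

Lemma mul_expRN_le (R : realType) (u : R) : 0 <= u -> u * expR (- u) <= 42 / 100.
Proof.
move=> u0; apply: (@le_trans _ _ (expR (- 1))).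
  have h : u <= expR (u - 1) by have := expR_ge1Dx (u - 1); lra.
  apply: le_trans (ler_wpM2r (expR_ge0 _) h) _.
  by rewrite -expRD ler_expR; lra.
have h : 5 / 4 <= expR (1 / 4) :> R by have := expR_ge1Dx (1 / 4 : R); lra.
have h2 : 25 / 16 <= expR (1 / 4) ^+ 2 :> R by nra.
have : 100 / 42 <= expR 1 :> R.
  rewrite (_ : 1 = 4%:R * (1 / 4)); last by field.
  by rewrite expRM_natl (exprM _ 2 2); nra.
rewrite expRN -[42 / 100]invf_div lef_pV2 // posrE ?expR_gt0 //; lra.
Qed.

Lemma ler_powR_exp (R : realType) (n t a b : R) :
  0 < n -> 0 <= b -> n `^ a <= t -> n `^ (a * b) <= t `^ b.
Proof.
move=> n0 b0 h; rewrite powRrM ge0_ler_powR ?nnegrE ?powR_ge0 //.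
exact: le_trans (powR_ge0 _ _) h.
Qed.

Lemma expR_le_num_indep (R : realType) (k : nat) (H : hypergraph) (x : R) :
  uniform_hg k.+1 H -> x <= 0 -> expR x <= (num_indep_hg H)%:R.
Proof.
move=> uH x0; apply: (@le_trans _ _ 1); first by rewrite -expR0 ler_expR.
by rewrite ler1n (num_indep_gt0 uH).
Qed.

Theorem theorem4 (R : realType) (k : nat) (eps : R) (hk : (1 <= k)%N)
    (heps0 : 0 < eps) (heps1 : eps < 4 / (k%:R + 1)) :
  exists n0 : nat,
    forall (P : hypergraph -> Prop) (f : R -> R),
      hereditary_hg P ->
      (forall t : R, 0 < t -> 0 <= f t) ->
      (forall s t : R, 0 < s -> s <= t -> f s <= f t) ->
      (forall (H : hypergraph) (t : R),
          P H -> uniform_hg k.+1 H -> 0 < t -> avg_degree_hg R k.+1 H <= t ->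
          (order_hg H)%:R / t `^ (1 / k%:R) * f t <= (alpha_hg H)%:R) ->
      forall (H : hypergraph) (t : R),
        P H -> uniform_hg k.+1 H -> (n0 <= order_hg H)%N ->
        0 < t -> avg_degree_hg R k.+1 H <= t -> t < (order_hg H)%:R ^+ k ->
        expR (alpha'_hg k eps f H t * ((order_hg H)%:R / t `^ (1 / k%:R))
              * ln t)
          <= (num_indep_hg H)%:R.
Proof.
have k1 : 1 <= k%:R :> R by rewrite ler1n.
have k0 : 0 < k%:R :> R by lra.
have ek : eps * (k%:R + 1) < 4 by rewrite -ltr_pdivlMr //; lra.
(* The constants c1 and c2 are the factors 1/(k+1) and (1 - eps)/(k (2k+1)) of the statement; its
   powers of t inside [f] are then 1 - K c1 and 1 - K c2. *)
pose K : R := k%:R; have K1 : 1 <= K by [].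
pose c1 : R := 1 / (K + 1); pose c2 : R := (1 - eps) / (K * (2 * K + 1)).
have kc1 : 1 - K * c1 = 1 / (K + 1) by rewrite /c1; field; rewrite gt_eqF //; lra.
have kc2 : 1 - K * c2 = (2 * K + eps) / (2 * K + 1).
  by rewrite /c2; field; rewrite !gt_eqF //; lra.
have [na Hna] := @natr_powR_unbounded R (eps / 840) 704 ltac:(lra).
have [nb Hnb] : exists n0 : nat, forall n : nat, (n0 <= n)%N ->
    4 <= n%:R `^ (1 - K * c1 - eps / 21).
  apply: natr_powR_unbounded; rewrite kc1 subr_gt0 ltr_pdivlMr; last lra.
  by lra.
have [nc Hnc] : exists n0 : nat, forall n : nat, (n0 <= n)%N ->
    64 * k.+1%:R ^+ 2 <= n%:R `^ (K * (1 - eps / 20) * (1 - K * c1) - eps / 7).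
  apply: natr_powR_unbounded; rewrite kc1 subr_gt0 mulrA mulr1 ltr_pdivlMr; last lra.
  by rewrite /K; nra.
have kc2' : eps < 1 -> 0 <= K * c2 <= 1 / 3.
  move=> e1; have -> : K * c2 = (1 - eps) / (2 * K + 1).
    by rewrite /c2; field; rewrite !gt_eqF //; lra.
  apply/andP; split; first by rewrite divr_ge0 //; lra.
  by rewrite ler_pdivrMr; lra.
(* In the non-linear case, sampling serves only for eps < 1, where c2 > 0. *)
have [nd Hnd] : exists n0 : nat, eps < 1 -> forall n : nat, (n0 <= n)%N ->
    4 <= n%:R `^ (1 - K * c2 - eps / 21).
  have [e1|_] := ltP eps 1; last by exists 0%N.
  have /andP[h1 h2] := kc2' e1.
  have [|n0 hn0] := @natr_powR_unbounded R (1 - K * c2 - eps / 21) 4; first lra.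
  by exists n0.
have [ne Hne] : exists n0 : nat, eps < 1 -> forall n : nat, (n0 <= n)%N ->
    64 * k.+1%:R ^+ 2 <=
      n%:R `^ (K * (1 - eps / 20) * (1 - c2) - (K - 1) - eps / 7).
  have [e1|_] := ltP eps 1; last by exists 0%N.
  have /andP[h1 h2] := kc2' e1.
  have [|n0 hn0] := @natr_powR_unbounded R
    (K * (1 - eps / 20) * (1 - c2) - (K - 1) - eps / 7) (64 * k.+1%:R ^+ 2).
    (* Positive because the three subtracted terms stay below 1/5, 1/3 and 1/7. *)
    have -> : K * (1 - eps / 20) * (1 - c2) - (K - 1) - eps / 7 =
      1 - K * eps / 20 - (K * c2) * (1 - eps / 20) - eps / 7 by field.
    have : (K * c2) * (1 - eps / 20) <= 1 / 3 by nra.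
    have : K * eps < 4 by rewrite /K; nra.
    by lra.
  by exists n0.
(* All thresholds depend on k and eps alone, so n0 is uniform in P and [f]. *)
exists (4 + na + nb + nc + nd + ne)%N.
move=> P f hP f0 fmono hf H t PH uH hn t0 ht tn.
set n := order_hg H in hn tn *.
have [n4 hna hnb] : [/\ 4 <= n, na <= n & nb <= n]%N by clear -hn; split; lia.
have [hnc hnd hne] : [/\ nc <= n, nd <= n & ne <= n]%N by clear -hn; split; lia.
have {}Hna := Hna n hna; have {}Hnb := Hnb n hnb; have {}Hnc := Hnc n hnc.
have {}Hnd e1 := Hnd e1 n hnd; have {}Hne e1 := Hne e1 n hne.
have n0 : (0 < n)%N by exact: leq_trans n4.
have nR0 : 0 < n%:R :> R by rewrite ltr0n.
have nR1 : 1 <= n%:R :> R by rewrite ler1n.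
have u0 : 0 < t `^ (1 / k%:R) by exact: powR_gt0.
have nu0 : 0 <= n%:R / t `^ (1 / k%:R) by rewrite divr_ge0 // ltW.
set q := n%:R `^ (- (eps / 21)).
have q0 : 0 < q by exact: powR_gt0.
have q1 : q <= 1.
  by rewrite -[X in _ <= X](powRr0 n%:R) ler_powR // oppr_le0 divr_ge0 // ltW.
have fs0 a : 0 <= f (t `^ a) by rewrite f0 // powR_gt0.
rewrite /alpha'_hg -/n -/q -/K; case: ifPn => [lin|nlin].
- have c10 : 0 <= c1 by rewrite /c1 divr_ge0 //; lra.
  have [t1|t1] := leP t 1.
    apply: (expR_le_num_indep uH).
    apply: mulr_ge0_le0; last exact: ln_le0.
    rewrite mulr_ge0 // mulr_ge0 // mulr_ge0 //; lra.
  have -> : (1 - q) * (1 / (K + 1)) * f (t `^ (1 / (K + 1))) *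
      (n%:R / t `^ (1 / K)) * ln t = (1 - q) * exponent_hg k n f t c1.
    by rewrite /exponent_hg -/K kc1 /c1; ring.
  apply: (num_indep_ge_main hk heps0 hP hf PH uH ht t1 tn c10 (fs0 _) n4
    Hna Hnb (D := id)) => [W v|tl m m0 hm].
    exact: (card_edges_at_linear_le v hk (uniform_hgP uH) (linear_hgP lin)).
  rewrite -/n -/K mulrA ler_wpM2r ?ler0n //.
  apply: (le_trans Hnc); rewrite addrC powRD_gt0 // ler_pM2l ?powR_gt0 //.
  by apply: ler_powR_exp => //; rewrite kc1 divr_ge0 //; lra.
have [t1|t1] := leP t 1; last first.
  have [e1|e1] := ltP eps 1; last first.
    apply: (expR_le_num_indep uH).
    rewrite mulr_le0_ge0 ?ln_ge0 ?(ltW t1) // mulr_le0_ge0 //.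
    rewrite mulr_le0_ge0 // mulr_ge0_le0 //; first by lra.
    by rewrite mulr_le0_ge0 ?invr_ge0 //; [lra|rewrite mulr_ge0 //; lra].
  have c20 : 0 <= c2 by rewrite /c2 divr_ge0 ?mulr_ge0 //; lra.
  have -> : (1 - q) * ((1 - eps) / (K * (2 * K + 1))) *
      f (t `^ ((2 * K + eps) / (2 * K + 1))) * (n%:R / t `^ (1 / K)) * ln t
      = (1 - q) * exponent_hg k n f t c2.
    by rewrite /exponent_hg -/K kc2 /c2; ring.
  apply: (num_indep_ge_main hk heps0 hP hf PH uH ht t1 tn c20 (fs0 _) n4
    Hna (Hnd e1) (D := fun m => (m ^ k)%N)) => [W v|tl m m0 hm].
    exact: (card_edges_at_le v (uniform_hgP uH)).
  rewrite -/n -/K; have mR0 : 0 < m%:R :> R by rewrite ltr0n.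
  (* One factor m cancels. The others are at most n t^(-c2) each, and the resulting t^(-c2 (k-1))
     cancels against t^(1 - K c2) = t^(1 - c2) t^(-c2 (k-1)), leaving a comparison of powers of n
     and t^(1 - c2). *)
  have -> : (m ^ k)%:R = m%:R ^+ k.-1 * m%:R :> R.
    by rewrite -exprSr prednK // natrX.
  rewrite [X in X <= _]mulrA [X in _ <= X]mulrA ler_wpM2r ?ler0n //.
  set tc := t `^ (- c2) in hm.
  have tc0 : 0 < tc by exact: powR_gt0.
  have hm' : m%:R ^+ k.-1 <= n%:R `^ (K - 1) * tc ^+ k.-1.
    have -> : n%:R `^ (K - 1) = n%:R ^+ k.-1.
      rewrite -powR_mulrn ?ltW //; congr (_ `^ _).
      by rewrite /K -[in LHS](prednK hk) -natr1 addrK.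
    rewrite -exprMn lerXn2r // nnegrE ?ler0n //.
    by rewrite mulr_ge0 ?ltW.
  have st : t `^ (1 - K * c2) = t `^ (1 - c2) * tc ^+ k.-1.
    rewrite /tc -powR_mulrn ?powR_ge0 // -powRrM -powRD_gt0 //; congr (_ `^ _).
    have -> : k.-1%:R = K - 1 by rewrite /K -[in RHS](prednK hk) -natr1 addrK.
    by ring.
  rewrite st.
  apply: (@le_trans _ _ (n%:R `^ (K * (1 - eps / 20) * (1 - c2) - (K - 1) - eps / 7)
     * (n%:R `^ (K - 1) * tc ^+ k.-1))).
    apply: ler_pM hm'; [|by rewrite exprn_ge0 ?ler0n|exact: Hne].
    by apply: mulr_ge0 => //; exact: exprn_ge0.
  rewrite !mulrA ler_wpM2r ?exprn_ge0 ?(ltW tc0) //.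
  rewrite -powRD_gt0 // (_ : _ + (K - 1) =
    - (eps / 7) + K * (1 - eps / 20) * (1 - c2)); last by ring.
  rewrite powRD_gt0 // ler_pM2l ?powR_gt0 //.
  have /andP[_ h2] := kc2' e1.
  by apply: ler_powR_exp => //; rewrite /K in h2; nra.
have [e1|e1] := leP eps 1.
  apply: (expR_le_num_indep uH); apply: mulr_ge0_le0; last exact: ln_le0.
  rewrite mulr_ge0 // mulr_ge0 // mulr_ge0 //; first lra.
  by rewrite divr_ge0 ?mulr_ge0 //; lra.
(* Here both 1 - eps and ln t are negative, so the exponent is positive; it is
   at most n / e, while the deletion of a vertex from each edge leaves
   2n/3 vertices, and 1 / e < (2 / 3) ln 2. *)
have k2 : (1 < k)%N.
  rewrite ltn_neqAle hk andbT; apply/eqP => kE.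
  by move: uH nlin; rewrite -kE => /linear_uniform2 ->.
apply: le_trans (num_indep_ge_sparse k2 uH n0 ht t1); rewrite ler_expR -/n.
(* With u = - (a ln t) >= 0 one has t^a = e^(-u); since f s / t^(1/k) <= t^a, the exponent is at
   most n u e^(-u). *)
pose a := - c2.
have a0 : 0 < a.
  rewrite /a /c2 -mulNr divr_gt0 ?mulr_gt0 //; lra.
set s := t `^ _.
have s0 : 0 < s by exact: powR_gt0.
have fs : f s <= s `^ (1 / k%:R) by apply: (hereditary_bound_le hk hP hf PH uH n0 s0).
have lnt : ln t <= 0 by exact: ln_le0.
have L0 : 0 <= - (a * ln t) by rewrite oppr_ge0 mulr_ge0_le0 // ltW.
have Ha := mul_expRN_le L0.
have Et : expR (- - (a * ln t)) = t `^ a by rewrite opprK /powR gt_eqF.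
rewrite Et in Ha.
have Es : s `^ (1 / k%:R) = t `^ (1 / k%:R) * t `^ a.
  rewrite /s -kc2 -powRrM -powRD_gt0 //; congr (_ `^ _); rewrite /a /K.
  by field; rewrite gt_eqF.
have -> : (1 - q) * ((1 - eps) / (K * (2 * K + 1))) * f s *
    (n%:R / t `^ (1 / K)) * ln t =
    n%:R * ((1 - q) * (- (a * ln t) * (f s / t `^ (1 / k%:R)))).
  by rewrite -/c2 /a /K; ring.
rewrite [X in _ <= X]mulrC ler_pM2l //.
have fu : f s / t `^ (1 / k%:R) <= t `^ a.
  by rewrite ler_pdivrMr // mulrC -Es.
have fu0 : 0 <= f s / t `^ (1 / k%:R) by rewrite divr_ge0 ?f0 // ltW.
have z0 : 0 <= - (a * ln t) * (f s / t `^ (1 / k%:R)) by exact: mulr_ge0.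
apply: le_trans (le_trans (ler_wpM2l L0 fu) Ha); apply: ler_piMl z0 _.
by rewrite gerBl ltW.
Qed.
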